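(* Let $\pi=(d_{1},\ldots,d_{n})$ be a non-increasing positive graphic sequence, with realizations taken on the vertex set $V=\{v_1,\ldots,v_n\}$ with $v_i$ of degree $d_i$. Let $F$ be a graph on $V$ that is a subgraph of some realization of $\pi$, and let $r=\Delta(F)$ be its maximum degree. If \[d_{d_{1}-d_{n}+2r+1}\geq d_{1}-d_{n}+2r,\] then there exists a realization $G$ of $\pi$ with $E(F)\subseteq E(G)$ such that $\mathrm{def}(G-E(F))\leq 1$.
   Context: All graphs are finite and simple. A sequence is graphic if it is the degree sequence of some simple graph (a realization). Non-increasing means $d_1\ge\cdots\ge d_n$; positive means all $d_i\ge1$. The hypothesis is understood with the subscript $d_1-d_n+2r+1$ lying in $\{1,\ldots,n\}$. For a graph $H$, $o(H)$ is the number of components of $H$ with an odd number of vertices, and $\mathrm{def}(H)=\max_{S\subseteq V(H)}\big(o(H-S)-|S|\big)$ (so a maximum matching of an $n$-vertex $H$ has $\frac12(n-\mathrm{def}(H))$ edges). $G-E(F)$ is the graph on $V$ with edge set $E(G)\setminus E(F)$. *)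

(* Defs.v *)
From mathcomp Require Import all_boot.

Set Implicit Arguments.
Unset Strict Implicit.
Unset Printing Implicit Defensive.

Record sgraph (T : finType) := SGraph {
  adj :> rel T;
  adj_sym : symmetric adj;
  adj_irr : irreflexive adj
}.

Section Graphs.
Variable T : finType.
Implicit Types (F G H : sgraph T) (A S : {set T}).

Definition degree G (x : T) : nat := #|[set y | G x y]|.

Definition max_degree G : nat := \max_(x : T) degree G x.

Definition subgraph F G : Prop := forall x y : T, F x y -> G x y.

Definition edge_diff_rel G F : rel T := [rel x y | G x y && ~~ F x y].

Lemma edge_diff_sym G F : symmetric (edge_diff_rel G F).
Proof. by move=> x y; rewrite /edge_diff_rel /= (adj_sym G) (adj_sym F). Qed.

Lemma edge_diff_irr G F : irreflexive (edge_diff_rel G F).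
Proof. by move=> x; rewrite /edge_diff_rel /= (adj_irr G). Qed.

(* G - E(F), with the same vertex set as G. *)
Definition edge_diff G F : sgraph T :=
  SGraph (edge_diff_sym G F) (edge_diff_irr G F).

(* Vertex sets of the connected components of the induced subgraph H[A]:
   paths may only use vertices of A, and only classes inside A are kept. *)
Definition components_in H A : {set {set T}} :=
  equivalence_partition
    (connect [rel x y | [&& x \in A, y \in A & H x y]]) A.

(* o(H - S) *)
Definition odd_components_del H S : nat :=
  #|[set C in components_in H (~: S) | odd #|C|]|.

(* The subtraction is truncated at 0; this does not change the maximum, since
   S = set0 already contributes o(H) >= 0. *)
Definition deficiency H : nat :=
  \max_(S : {set T}) (odd_components_del H S - #|S|).

End Graphs.

Section DegreeSequences.
Variable n : nat.
Implicit Types (d : n.-tuple nat) (G : sgraph 'I_n).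

(* The ordinal i stands for the vertex v_(i+1). *)
Definition realizes G d : Prop := forall i : 'I_n, degree G i = tnth d i.

Definition graphic d : Prop := exists G, realizes G d.

(* d_k in 1-based indexing; meaningful only for 1 <= k <= n. *)
Definition term d (k : nat) : nat := nth 0 d k.-1.

Definition nonincreasing d : Prop :=
  forall i j : 'I_n, i <= j -> tnth d j <= tnth d i.

Definition positive_seq d : Prop := forall i : 'I_n, 1 <= tnth d i.

End DegreeSequences.

(* Main.v *)
Require Import Defs.
From mathcomp Require Import all_boot.
From Stdlib Require Import Classical.
From mathcomp Require Import zify.

Set Implicit Arguments.
Unset Strict Implicit.
Unset Printing Implicit Defensive.

(** Among all realizations G containing F and all matchings N of H = G - E(F),
    take a pair missing as few vertices as possible, and suppose that at least
    two are missed.  Let D be the set of vertices missed by some optimal matching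
    of H, A the set of neighbours of D outside D, and m = d_n - r.  Gallai-Edmonds
    theory shows that H[D] has more than |A| components; if each of them sends at
    least m edges to A, then some u in A has more than m neighbours in D.

    Let K be the set of vertices of degree at least d_1 - d_n + 2r; it has more
    than d_1 - d_n + 2r elements.  If no vertex of K can be missed, a 2-switch that
    would free z in K shows that the H-neighbours of a missed vertex are adjacent
    in G to all of K but at most r vertices, and then u has degree above d_1.  So
    some z in K can be missed.  Running the argument in H - z instead, a 2-switch
    creating the edge zq shows that the H-neighbours of z and of a vertex q missed
    with z are joined completely in G when zq is not in F, and again u has degree
    above d_1. *)

(** * Matchings as involutions, and exchanges between two of them *)

Section Involutions.
Variable T : finType.
Implicit Types (M N : {ffun T -> T}) (C : {set T}).

(** A matching is encoded as the involution exchanging the ends of each of its edges, so the fixed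
    points are the missed vertices. *)
Definition exposed N : {set T} := [set x | N x == x].

(** The points of [C] moved by [N] split into pairs [{x, N x}]; the induction removes one pair at a
    time. *)
Lemma involution_parity N C :
  involutive N -> (forall x, x \in C -> N x \in C) ->
  odd #|exposed N :&: C| = odd #|C|.
Proof.
move=> NK; move: {2}#|C| (leqnn #|C|) => n.
elim: n C => [|n IHn] C.
  by rewrite leqn0 cards_eq0 => /eqP-> _; rewrite setI0.
move=> leCn CN.
have [/subsetP sCE | /subsetPn[x xC]] := boolP (C \subset exposed N).
  by rewrite (setIidPr _) //; apply/subsetP.
rewrite inE => Nx.
have NxC := CN _ xC.
have cC : #|C| = #|C :\ x :\ N x|.+2.
  by rewrite (cardsD1 x C) xC (cardsD1 (N x) (C :\ x)) !inE Nx NxC.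
have -> : exposed N :&: C = exposed N :&: (C :\ x :\ N x).
  apply/setP=> y; rewrite !inE; case: eqP => //= yy.
  have -> : y != N x by apply/eqP=> yE; case/eqP: Nx; rewrite -yE -[in RHS](NK x) -yE yy.
  by have -> : y != x by apply/eqP=> yE; case/eqP: Nx; rewrite -yE.
rewrite IHn ?cC ?oddS ?negbK //; first by rewrite cC in leCn; lia.
move=> y; rewrite !inE => /and3P[y1 y2 yC].
rewrite CN // (inj_eq (can_inj NK)) y2 andbT /=.
by apply: contraNneq y1 => <-; rewrite NK.
Qed.

Lemma exposed_parity N : involutive N -> odd #|exposed N| = odd #|T|.
Proof.
move=> NK; rewrite -cardsT -(@involution_parity N setT) ?setIT //.
Qed.

(* The orbit of [q] under [M \o N] is a path of the union of the two matchings: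
   reading the exponents modulo the length [L] of the orbit, [M] is [i |-> -i]
   and [N] is [i |-> -i - 1], so a second exposed vertex sits at [L / 2]. *)
Lemma alternating_component M N q :
  involutive M -> involutive N -> M q = q ->
  exists C : {set T}, [/\ q \in C, forall x, x \in C -> M x \in C,
    forall x, x \in C -> N x \in C &
    #|exposed M :&: C| + #|exposed N :&: C| <= 2].
Proof.
move=> MK NK Mq; pose s x := M (N x).
have s_inj : injective s by exact: inj_comp (can_inj MK) (can_inj NK).
have sM i : iter i s (M (iter i s q)) = q.
  elim: i => [|i IHi] //; rewrite [in X in M X]iterS /s MK iterSr /= -/s.
  by rewrite /s NK -/s IHi.
have sN i : iter i.+1 s (N (iter i s q)) = q.
  by rewrite iterSr /s NK -/s sM.
set L := order s q.
have iterL : iter L s q = q by exact: iter_order.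
(* [L] is the first return time to [q], so the only return strictly between 0 and [2L] is at [L].
   This is used with [j = 2i] for [M] and [j = 2i + 1] for [N]. *)
have ret j : 0 < j < L.*2 -> iter j s q = q -> j = L.
  move=> /andP[j0 jL] sj; have [lt|le] := ltnP j L.
    by have := findex_iter lt; rewrite sj findex0; lia.
  have ltj : j - L < L by lia.
  have := findex_iter ltj.
  rewrite (_ : iter (j - L) s q = q) ?findex0; first by lia.
  by rewrite -{1}iterL -iterD subnK.
exists [set x | fconnect s q x]; split.
- by rewrite inE.
- move=> x; rewrite !inE => /iter_findex <-.
  rewrite (fconnect_sym s_inj); apply/connectP.
  set i := findex _ _ _.
  exists (traject s (s (M (iter i s q))) i); first exact: fpath_traject.
  by rewrite last_traject sM.
- move=> x; rewrite !inE => /iter_findex <-.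
  rewrite (fconnect_sym s_inj); apply/connectP.
  set i := findex _ _ _.
  exists (traject s (s (N (iter i s q))) i.+1); first exact: fpath_traject.
  by rewrite last_traject sN.
have eM x : x \in exposed M :&: [set x | fconnect s q x] ->
    x = q \/ (~~ odd L /\ x = iter L./2 s q).
  rewrite !inE => /andP[/eqP Mx qx]; have := iter_findex qx.
  have := findex_max qx; set i := findex _ _ _ => iL xE.
  have := sM i; rewrite !xE Mx -{1}xE -iterD => sii.
  have [i0|i0] := posnP i; first by left; rewrite -xE i0.
  by right; have iiL := ret _ _ sii; split; [lia|rewrite -xE; congr iter; lia].
have eN x : x \in exposed N :&: [set x | fconnect s q x] ->
    odd L /\ x = iter L./2 s q.
  rewrite !inE => /andP[/eqP Nx qx]; have := iter_findex qx.
  have := findex_max qx; set i := findex _ _ _ => iL xE.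
  have := sN i; rewrite !xE Nx -{1}xE -iterD => sii.
  by have iiL := ret _ _ sii; split; [lia|rewrite -xE; congr iter; lia].
have [oL|oL] := boolP (odd L).
- apply: (@leq_add _ _ 1 1); rewrite -(cards1 q).
    apply/subset_leq_card/subsetP=> x /eM[->|[]]; rewrite ?inE //.
    by rewrite oL.
  rewrite cards1 -(cards1 (iter L./2 s q)).
  by apply/subset_leq_card/subsetP=> x /eN[_ ->]; rewrite inE.
- apply: (@leq_add _ _ 2 0).
    apply: leq_trans (_ : #|[set q; iter L./2 s q]| <= 2); last by rewrite cards2; case: eqP.
    by apply/subset_leq_card/subsetP=> x /eM[->|[_ ->]]; rewrite !inE eqxx ?orbT.
  rewrite leqn0 cards_eq0; apply/eqP/setP=> x; rewrite in_set0.
  by apply/negP=> /eN[]; rewrite (negPf oL).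
Qed.

Definition glue C M N : {ffun T -> T} := [ffun x => if x \in C then M x else N x].

Lemma glueK C M N : involutive M -> involutive N ->
  (forall x, x \in C -> M x \in C) -> (forall x, x \in C -> N x \in C) ->
  involutive (glue C M N).
Proof.
move=> MK NK CM CN x; rewrite !ffunE; have [xC|xC] := boolP (x \in C).
  by rewrite CM // MK.
by rewrite ifN ?NK //; apply: contra xC => /CN; rewrite NK.
Qed.

Lemma card_exposed_glue C M N :
  #|exposed (glue C M N)| + #|exposed N :&: C| = #|exposed N| + #|exposed M :&: C|.
Proof.
rewrite -(cardsID C (exposed (glue C M N))) -(cardsID C (exposed N)).
have -> : exposed (glue C M N) :&: C = exposed M :&: C.
  by apply/setP=> x; rewrite !inE ffunE; case: (x \in C); rewrite ?andbF.
have -> : exposed (glue C M N) :\: C = exposed N :\: C.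
  by apply/setP=> x; rewrite !inE ffunE; case: (x \in C).
lia.
Qed.

Definition add_edge N p q : {ffun T -> T} :=
  [ffun x => if x == p then q else if x == q then p else N x].

Lemma add_edgeK N p q : involutive N -> N p = p -> N q = q ->
  involutive (add_edge N p q).
Proof.
move=> NK Np Nq x; rewrite !ffunE.
case: (eqVneq x p) => [->|xp]; first by rewrite eqxx; case: eqP.
case: (eqVneq x q) => [->|xq]; first by rewrite eqxx.
rewrite !ifN ?NK //; apply/eqP => Nx.
  by case/eqP: xq; rewrite -Nq -Nx NK.
by case/eqP: xp; rewrite -Np -Nx NK.
Qed.

Lemma card_exposed_add N p q : N p = p -> N q = q -> p != q ->
  #|exposed N| = #|exposed (add_edge N p q)|.+2.
Proof.
move=> Np Nq pq; rewrite (cardsD1 p) (cardsD1 q (_ :\ _)) !inE Np Nq eqxx eq_sym pq eqxx.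
rewrite !add1n; do 2 congr _.+1; apply: eq_card => x; rewrite !inE ffunE.
case: (eqVneq x p) => [->|xp]; first by rewrite andbF eq_sym (negPf pq).
by case: (eqVneq x q) => [->|xq] //=; rewrite (negPf pq).
Qed.

Definition del_edge N a : {ffun T -> T} :=
  [ffun x => if (x == a) || (x == N a) then x else N x].

Lemma del_edgeK N a : involutive N -> involutive (del_edge N a).
Proof.
move=> NK x; rewrite !ffunE.
case: (eqVneq x a) => [->|xa] /=; first by rewrite eqxx.
case: (eqVneq x (N a)) => [->|xNa]; first by rewrite eqxx orbT.
rewrite ifN ?NK // (inj_eq (can_inj NK)) negb_or xa andbT.
by apply: contraNneq xNa => <-; rewrite NK.
Qed.

Lemma card_exposed_del N a : involutive N -> N a != a ->
  #|exposed (del_edge N a)| = #|exposed N|.+2.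
Proof.
move=> NK Na; rewrite (cardsD1 a) (cardsD1 (N a) (_ :\ _)) !inE !ffunE !eqxx orbT Na !eqxx.
rewrite !add1n; do 2 congr _.+1; apply: eq_card => x; rewrite !inE ffunE.
case: (eqVneq x a) => [->|xa] /=; first by rewrite andbF (negPf Na).
by case: (eqVneq x (N a)) => [->|xq] //=; rewrite NK eq_sym (negPf Na).
Qed.

End Involutions.

(** * Double counting *)

Section DoubleCounting.
Variable T : finType.
Implicit Types (A B P Y : {set T}) (H : sgraph T).

Lemma card_setI_sum A Y : #|Y :&: A| = \sum_(x in A) (x \in Y).
Proof.
rewrite -sum1_card big_mkcond [RHS]big_mkcond /=; apply: eq_bigr => x _.
by rewrite inE; case: (x \in A); case: (x \in Y).
Qed.

Lemma sum_card_meet (PP : {set {set T}}) A Y :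
  partition PP A -> \sum_(P in PP) #|Y :&: P| = #|Y :&: A|.
Proof.
move=> partA; rewrite card_setI_sum (set_partition_big _ partA) /=.
by apply: eq_bigr => P _; exact: card_setI_sum.
Qed.

Lemma double_count H A B :
  \sum_(a in A) #|[set b in B | H a b]| = \sum_(b in B) #|[set a in A | H b a]|.
Proof.
have E x Y : #|[set y in Y | H x y]| = \sum_(y in Y) H x y :> nat.
  rewrite (_ : [set y in Y | H x y] = [set y | H x y] :&: Y).
    by rewrite card_setI_sum; apply: eq_bigr => y _; rewrite inE.
  by apply/setP=> y; rewrite !inE andbC.
under eq_bigr do rewrite E; under [RHS]eq_bigr do rewrite E.
rewrite exchange_big /=; apply: eq_bigr => b _; apply: eq_bigr => a _.
by rewrite adj_sym.
Qed.

End DoubleCounting.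

(** * Components of an induced subgraph *)

Section Components.
Variables (T : finType) (H : sgraph T) (A : {set T}).
Let R := [rel x y | [&& x \in A, y \in A & H x y]].

Lemma connect_in_sym : connect_sym R.
Proof.
by apply: sym_connect_sym => x y /=; rewrite (adj_sym H) andbCA.
Qed.

Lemma components_partition : partition (components_in H A) A.
Proof.
apply: equivalence_partitionP => x y z _ _ _; split=> // xy.
exact: (same_connect connect_in_sym).
Qed.

Lemma mem_componentP P x y : P \in components_in H A -> x \in P ->
  (y \in P) = (y \in A) && connect R x y.
Proof.
case/imsetP=> x0 _ ->; rewrite !inE => /andP[xA x0x].
by rewrite (same_connect connect_in_sym x0x).
Qed.

Lemma component_sub P : P \in components_in H A -> P \subset A.
Proof. by case/imsetP=> x0 _ ->; apply/subsetP=> x; rewrite inE => /andP[]. Qed.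

Lemma component_adj P x y : P \in components_in H A -> x \in P ->
  y \in A -> H x y -> y \in P.
Proof.
move=> PA xP yA xy; rewrite (mem_componentP _ PA xP) yA connect1 //=.
by rewrite (subsetP (component_sub PA) _ xP) yA.
Qed.

Lemma component_neq0 P : P \in components_in H A -> P != set0.
Proof. by move=> PA; have /and3P[_ _] := components_partition; apply: contraNneq => <-. Qed.

Lemma component_neighbor P x : P \in components_in H A -> 1 < #|P| -> x \in P ->
  exists2 y, y \in P & H x y.
Proof.
move=> PA P1 xP; have xA := subsetP (component_sub PA) _ xP.
have /set0Pn[z] : P :\ x != set0 by rewrite -card_gt0; rewrite (cardsD1 x) xP in P1.
rewrite !inE => /andP[zx]; rewrite (mem_componentP _ PA xP) => /andP[_].
case/connectP=> -[|y p] /=; first by move=> _ zE; rewrite zE eqxx in zx.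
case/andP=> /and3P[_ yA xy] _ _; exists y => //; exact: component_adj xy.
Qed.

End Components.

(** * Maximum matchings and the Gallai-Edmonds sets *)

Section Matchings.
Variables (T : finType) (H : sgraph T).
Implicit Types (V W C : {set T}) (M N : {ffun T -> T}).

(** [N] acts on all of [T] and fixes every vertex outside [V], so deleting a vertex changes [V] but
    not the type; [exposed N] then also counts the complement of [V]. *)
Definition matching V N : bool :=
  [forall x, (N (N x) == x) && ((N x != x) ==> (x \in V) && H x (N x))].

Lemma matchingP V N :
  reflect (involutive N /\ forall x, N x != x -> x \in V /\ H x (N x)) (matching V N).
Proof.
apply: (iffP forallP) => [h|[NK h] x].
  split=> x; have /andP[/eqP // _ /implyP hx] := h x.
  by move=> /hx/andP.
by rewrite NK eqxx; apply/implyP => /h[-> ->].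
Qed.

Lemma matchingK V N : matching V N -> involutive N.
Proof. by case/matchingP. Qed.

Lemma matching_adj V N x : matching V N -> N x != x -> H x (N x).
Proof. by case/matchingP=> _ h /h[]. Qed.

Lemma matching_sub V W N : V \subset W -> matching V N -> matching W N.
Proof.
by move=> /subsetP VW /matchingP[NK h]; apply/matchingP; split=> // x /h[/VW].
Qed.

Lemma matching_out V N x : matching V N -> x \notin V -> N x = x.
Proof.
by move=> /matchingP[NK h] xV; apply/eqP; apply: contraNT xV => /h[].
Qed.

Lemma matching_glue V M N C : matching V M -> matching V N ->
  (forall x, x \in C -> M x \in C) -> (forall x, x \in C -> N x \in C) ->
  matching V (glue C M N).
Proof.
move=> /matchingP[MK hM] /matchingP[NK hN] CM CN; apply/matchingP; split.
  exact: glueK.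
by move=> x; rewrite ffunE; case: ifP => _; [exact: hM | exact: hN].
Qed.

Lemma matching_add V N p q : matching V N -> p \in V -> q \in V ->
  N p = p -> N q = q -> H p q -> matching V (add_edge N p q).
Proof.
move=> /matchingP[NK h] pV qV Np Nq pq; apply/matchingP; split.
  exact: add_edgeK.
move=> x; rewrite ffunE; case: (eqVneq x p) => [->|_] //.
case: (eqVneq x q) => [->|_]; last exact: h.
by rewrite (adj_sym H).
Qed.

Lemma matching_del V N a : matching V N -> matching (V :\ a) (del_edge N a).
Proof.
move=> /matchingP[NK h]; apply/matchingP; split; first exact: del_edgeK.
move=> x; rewrite ffunE; case: ifP; first by rewrite eqxx.
by move/negbT; rewrite negb_or !inE => /andP[-> _] /h.
Qed.

Lemma card_exposed_in V N : matching V N ->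
  #|exposed N| = #|exposed N :&: V| + #|~: V|.
Proof.
move=> mN; rewrite -(cardsID V (exposed N)); congr (_ + #|pred_of_set _|).
apply/setP=> x; rewrite !inE; case: (boolP (x \in V)) => //= xV.
by rewrite (matching_out mN xV) eqxx.
Qed.

(** The easy half of Berge's formula: an odd component of [H - S] cannot be matched within itself,
    so it has a vertex that is missed or matched into [S]. These vertices form [Y], which [N]
    injects into [S :|: exposed N]. *)
Lemma deficiency_le_exposed N : matching setT N -> deficiency H <= #|exposed N|.
Proof.
move=> mN; have NK := matchingK mN; apply/bigmax_leqP => S _.
rewrite leq_subLR /odd_components_del.
pose OC := [set C in components_in H (~: S) | odd #|C|].
rewrite -/OC; pose Y := [set v | N v \in S :|: exposed N].
have cY : #|Y| <= #|S| + #|exposed N|.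
  apply: leq_trans (leq_card_setU _ _).
  rewrite -(card_imset Y (can_inj NK)); apply/subset_leq_card/subsetP=> y.
  by case/imsetP=> v; rewrite inE => ? ->.
apply: leq_trans cY.
apply: leq_trans (subset_leq_card (subsetIl Y (~: S))).
rewrite -(sum_card_meet Y (components_partition H (~: S))) -sum1_card.
rewrite [leqRHS](bigID (mem OC)) /=; apply: leq_trans (leq_addr _ _).
rewrite [leqLHS](eq_bigl (fun C => (C \in components_in H (~: S)) && (C \in OC))); last first.
  by move=> C; rewrite inE andbA andbb.
apply: leq_sum => C /andP[CS]; rewrite /= inE CS /= => oC.
rewrite card_gt0; apply/negP => /eqP YC0.
have CN x : x \in C -> N x \in C.
  move=> xC; have := in_set0 x; rewrite -YC0 !inE xC andbT => /norP[NxS].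
  rewrite NK eq_sym => Nx.
  apply: (component_adj CS xC _ (matching_adj mN Nx)); by rewrite inE.
have := involution_parity NK CN; rewrite (_ : _ :&: _ = set0) ?cards0 ?oC //.
apply/setP=> x; rewrite !inE; apply/negP=> /andP[Nx xC].
by have := in_set0 x; rewrite -YC0 !inE xC (eqP Nx) Nx orbT.
Qed.

Definition max_matching V N : bool :=
  matching V N && [forall M, matching V M ==> (#|exposed N| <= #|exposed M|)].

Lemma max_matchingP V N : reflect
  (matching V N /\ forall M, matching V M -> #|exposed N| <= #|exposed M|)
  (max_matching V N).
Proof.
apply: (iffP andP) => -[mN h]; split=> //.
  by move=> M mM; have /forallP/(_ M)/implyP/(_ mM) := h.
by apply/forallP => M; apply/implyP/h.
Qed.

Lemma max_matching_eq V M N : max_matching V M -> max_matching V N ->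
  #|exposed M| = #|exposed N|.
Proof.
move=> /max_matchingP[mM hM] /max_matchingP[mN hN]; apply/eqP.
by rewrite eqn_leq hM // hN.
Qed.

Lemma max_matching_of_card V M N : max_matching V M -> matching V N ->
  #|exposed N| <= #|exposed M| -> max_matching V N.
Proof.
move=> /max_matchingP[mM hM] mN le; apply/max_matchingP; split=> // N' /hM.
exact: leq_trans.
Qed.

Lemma exposed_nonadj V N p q : max_matching V N -> p \in V -> q \in V ->
  N p = p -> N q = q -> ~~ H p q.
Proof.
move=> /max_matchingP[mN hN] pV qV Np Nq; apply/negP => pq.
have pNq : p != q by apply: contraTneq pq => ->; rewrite (adj_irr H).
have := hN _ (matching_add mN pV qV Np Nq pq).
by rewrite (card_exposed_add Np Nq pNq) ltnNge leqnSn.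
Qed.

(** Together with [frontier] below, the sets D and A of the Gallai-Edmonds decomposition of
    [H[V]]. *)
Definition missable V : {set T} :=
  [set q in V | [exists N, max_matching V N && (N q == q)]].

Lemma missableP V q :
  reflect (q \in V /\ exists2 N, max_matching V N & N q = q) (q \in missable V).
Proof.
rewrite inE; apply: (iffP andP) => -[qV].
  by case/existsP=> N /andP[mN /eqP Nq]; split=> //; exists N.
by case=> N mN Nq; split=> //; apply/existsP; exists N; rewrite mN Nq eqxx.
Qed.

Definition frontier V : {set T} :=
  [set a in V | (a \notin missable V) && [exists q in missable V, H a q]].

(** Exchange [N] with a maximum matching missing [q] along the alternating path from [q]. One of its
    at most two exposed ends is [q], so it cannot contain both [p] and [w], and whichever lies
    outside stays missed. *)
Lemma missed_together_step V N p q w : max_matching V N -> p != w ->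
  N p = p -> N w = w -> q \in missable V ->
  exists2 M, max_matching V M & M q = q /\ (M p = p \/ M w = w).
Proof.
move=> xN pw Np Nw /missableP[qV [M xM Mq]].
have [mM hM] := max_matchingP _ _ xM; have [mN hN] := max_matchingP _ _ xN.
have [MK NK] := (matchingK mM, matchingK mN).
have [C [qC CM CN le2]] := alternating_component MK NK Mq.
have := hM _ (matching_glue mN mM CN CM); have := hN _ (matching_glue mM mN CM CN).
have := card_exposed_glue C N M; have := card_exposed_glue C M N.
have eq := max_matching_eq xM xN.
have M1 : 0 < #|exposed M :&: C|.
  by rewrite card_gt0; apply/set0Pn; exists q; rewrite !inE Mq eqxx.
move=> e1 e2 l1 l2.
have N1 : #|exposed N :&: C| <= 1 by lia.
exists (glue C M N).
  by apply: max_matching_of_card xN (matching_glue mM mN CM CN) _; lia.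
rewrite !ffunE qC; split=> //.
case: (boolP (p \in C)) => [pC|_]; last by left.
case: (boolP (w \in C)) => [wC|_]; last by right.
suff : 1 < #|exposed N :&: C| by lia.
rewrite (cardsD1 p) !inE Np eqxx pC add1n ltnS card_gt0.
by apply/set0Pn; exists w; rewrite !inE Nw eqxx wC eq_sym pw.
Qed.

(* Gallai's lemma: being missed together propagates along a path of [H[missable V]]
   until it concerns two adjacent vertices. *)
Lemma component_exposed V N P p w : max_matching V N ->
  P \in components_in H (missable V) -> p \in P -> w \in P ->
  N p = p -> N w = w -> p = w.
Proof.
move=> xN PV pP wP Np Nw; apply/eqP/negPn/negP => pw.
have pD := subsetP (component_sub PV) _ pP.
move: wP; rewrite (mem_componentP _ PV pP) => /andP[_ /connectP[s]].
elim: s p N xN pw Np Nw {pP} pD => [|v s IHs] p N xN pw Np Nw pD /=.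
  by move=> _ wE; rewrite wE eqxx in pw.
case/andP=> /and3P[_ vD pv] pth wE.
have [pV vV] : p \in V /\ v \in V by move: pD vD; rewrite !inE => /andP[-> _] /andP[-> _].
have nadj M : max_matching V M -> M p = p -> M v = v -> False.
  by move=> xM Mp Mv; have := exposed_nonadj xM pV vV Mp Mv; rewrite pv.
have [vw|vw] := eqVneq v w; first by apply: (nadj N); rewrite // vw.
have [M xM [Mv [Mp|Mw]]] := missed_together_step xN pw Np Nw vD.
  exact: (nadj M).
exact: (IHs v M).
Qed.

(** A matching of [V :\ a] misses [a], so it is not maximum in [V]; by parity it misses at least two
    vertices more than [N], which is exactly the cost of deleting the edge at [a]. *)
Lemma max_matching_del V N a : max_matching V N -> a \in V -> a \notin missable V ->
  max_matching (V :\ a) (del_edge N a).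
Proof.
move=> xN aV aD; have [mN hN] := max_matchingP _ _ xN.
have NK := matchingK mN.
have Na : N a != a by apply: contraNneq aD => Na; apply/missableP; split=> //; exists N.
apply/max_matchingP; split=> [|M mM]; first exact: matching_del.
have mMV := matching_sub (subsetDl _ _) mM.
rewrite card_exposed_del //.
have oM := exposed_parity (matchingK mM); have oN := exposed_parity NK.
suff : #|exposed M| != #|exposed N| by have := hN _ mMV; lia.
apply: contraNneq aD => eMN; apply/missableP; split=> //; exists M.
  by apply: max_matching_of_card xN mMV _; rewrite eMN.
by apply: (matching_out mM); rewrite !inE eqxx.
Qed.

(* Gallai's stability lemma.  If [M] misses [q] in [V :\ a] and [N] misses a
   neighbour [d] of [a] in [V], exchanging [M] and [N] on the alternating path
   from [q] works unless that path ends at [a]; then the edge [ad] repairs the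
   size of the result. *)
Lemma missable_del V a : a \in frontier V -> missable (V :\ a) = missable V.
Proof.
rewrite inE => /and3P[aV aD /existsP[d /andP[dD ad]]].
have /missableP[dV [N xN Nd]] := dD.
have xNa := max_matching_del xN aV aD.
have [mN hN] := max_matchingP _ _ xN; have NK := matchingK mN.
have Na : N a != a by apply: contraNneq aD => Na; apply/missableP; split=> //; exists N.
have cNa := card_exposed_del NK Na.
apply/setP=> q; apply/idP/idP => [|qD]; last first.
  have qa : q != a by apply: contraNneq aD => <-.
  have /missableP[qV [M xM Mq]] := qD; apply/missableP; split.
    by rewrite !inE qa.
  exists (del_edge M a); first exact: max_matching_del.
  by rewrite ffunE; case: ifP => // _.
case/missableP; rewrite !inE => /andP[qa qV] [M xM Mq]; rewrite qV /=.
have [mM hM] := max_matchingP _ _ xM; have MK := matchingK mM.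
have Ma : M a = a by apply: (matching_out mM); rewrite !inE eqxx.
have cM : #|exposed M| = #|exposed N|.+2 by rewrite -cNa; apply: max_matching_eq xM xNa.
have mMV := matching_sub (subsetDl _ _) mM.
have [C [qC CM CN le2]] := alternating_component MK NK Mq.
have mNC := matching_glue mMV mN CM CN; have mMC := matching_glue mN mMV CN CM.
have cNC := card_exposed_glue C M N; have cMC := card_exposed_glue C N M.
have pM := involution_parity MK CM; have pN := involution_parity NK CN.
have M1 : 0 < #|exposed M :&: C|.
  by rewrite card_gt0; apply/set0Pn; exists q; rewrite !inE Mq eqxx.
have miss M' : matching V M' -> #|exposed M'| <= #|exposed N| -> M' q = q ->
    [exists M0, max_matching V M0 && (M0 q == q)].
  move=> mM' le M'q; apply/existsP; exists M'; rewrite M'q eqxx andbT.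
  exact: max_matching_of_card xN mM' le.
have par : odd #|exposed M :&: C| = odd #|exposed N :&: C| by rewrite pM.
(* Either each matching exposes one end of the path, and the exchange keeps the size of [N], or [M]
   exposes both ends. *)
have [[N1 M1']|[NC0 MC2]] : #|exposed N :&: C| = 1 /\ #|exposed M :&: C| = 1 \/
    #|exposed N :&: C| = 0 /\ #|exposed M :&: C| = 2.
  by move: le2 M1 par; case: #|exposed M :&: C| => [|[|[|k]]];
     case: #|exposed N :&: C| => [|[|k']] //; auto; lia.
  apply: (miss _ mNC); last by rewrite ffunE qC.
  by rewrite N1 M1' in cNC; clear -cNC; lia.
case: (boolP (a \in C)) => aC; last first.
  case/negP: aD; apply/missableP; split=> //; exists (glue C N M).
    by apply: max_matching_of_card xN mMC _; clear -cM cMC MC2 NC0; lia.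
  by rewrite ffunE (negPf aC).
have dC : d \notin C.
  apply/negP => dC; have := in_set0 d; rewrite -(cards0_eq NC0) !inE Nd eqxx dC.
  by [].
have da : d != a by apply: contraNneq aD => <-.
have qd : q != d by apply: contraNneq dC => <-.
have Ga : glue C M N a = a by rewrite ffunE aC.
have Gd : glue C M N d = d by rewrite ffunE (negPf dC).
have ada : a != d by rewrite eq_sym.
apply: (miss _ (matching_add mNC aV dV Ga Gd ad)).
  by have := card_exposed_add Ga Gd ada; clear -cNC MC2 NC0; lia.
by rewrite ffunE (negPf qa) (negPf qd) ffunE qC.
Qed.

Lemma frontier_del V a : a \in frontier V -> frontier (V :\ a) = frontier V :\ a.
Proof.
by move=> aV; apply/setP=> x; rewrite inE (missable_del aV) !in_setD1 -andbA [in RHS]inE.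
Qed.

(* The lower bound of the Gallai-Edmonds structure theorem on the number of
   components of [H[missable V]]. *)
Lemma frontier_exposed_le V N : max_matching V N ->
  #|frontier V| + #|exposed N :&: V| <= #|components_in H (missable V)|.
Proof.
move En : #|frontier V| => n; elim: n V N En => [|n IHn] V N En xN.
  (* With an empty frontier it is enough that each component contains at most one missed vertex,
     which is Gallai's lemma. *)
  have sD : exposed N :&: V \subset missable V.
    apply/subsetP=> x; rewrite in_setI => /andP[Nx xV]; apply/missableP; split=> //.
    by exists N => //; move: Nx; rewrite inE => /eqP.
  rewrite add0n -(setIidPl sD) -(sum_card_meet _ (components_partition H _)).
  rewrite -[leqRHS]sum1_card; apply: leq_sum => P PV.
  rewrite leqNgt; apply/negP => /card_gt1P[x [y [xP yP xy]]].
  move: xP yP; rewrite !inE => /andP[/andP[/eqP Nx xV] xP] /andP[/andP[/eqP Ny yV] yP].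
  by case/eqP: xy; exact: (component_exposed xN PV xP yP Nx Ny).
(* Deleting [a] preserves [missable], removes one frontier vertex and adds one missed vertex inside
   the vertex set, so the left-hand side does not change. *)
have [a aF] : exists a, a \in frontier V by apply/set0Pn; rewrite -card_gt0 En.
have [aV aD] : a \in V /\ a \notin missable V by move: aF; rewrite inE => /and3P[].
have xNa := max_matching_del xN aV aD.
have En' : #|frontier (V :\ a)| = n.
  by rewrite (frontier_del aF); rewrite (cardsD1 a) aF in En; case: En.
have := IHn _ _ En' xNa; rewrite (missable_del aF).
apply: leq_trans.
have [mN _] := max_matchingP _ _ xN; have NK := matchingK mN.
have Na : N a != a by apply: contraNneq aD => Na; apply/missableP; split=> //; exists N.
have [mNa _] := max_matchingP _ _ xNa.
have := card_exposed_in mN; have := card_exposed_in mNa; rewrite card_exposed_del //.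
have := cardsC V; have := cardsC (V :\ a); rewrite (cardsD1 a V) aV.
lia.
Qed.

(** Count the edges between D and A: there are more components than vertices of A, and each
    component sends at least [m] edges, so some vertex of A receives more than [m]. *)
Lemma frontier_heavy V N m : max_matching V N -> 0 < #|exposed N :&: V| -> 0 < m ->
  (forall P, P \in components_in H (missable V) ->
     m <= \sum_(q in P) #|[set a in frontier V | H q a]|) ->
  exists2 u, u \in frontier V & m < #|[set q in missable V | H u q]|.
Proof.
move=> xN N0 m0 hP.
have [/existsP[u /andP[uF mu]]|noex] :=
  boolP [exists u in frontier V, m < #|[set q in missable V | H u q]|].
  by exists u.
have := frontier_exposed_le xN; set c := #|components_in _ _| => lec.
have ub : \sum_(u in frontier V) #|[set q in missable V | H u q]| <= #|frontier V| * m.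
  rewrite -sum_nat_const; apply: leq_sum => u uF; rewrite leqNgt.
  by apply: contra noex => mu; apply/existsP; exists u; rewrite uF.
have lb : c * m <= \sum_(q in missable V) #|[set a in frontier V | H q a]|.
  rewrite (set_partition_big _ (components_partition H (missable V))) /=.
  by rewrite -sum_nat_const; apply: leq_sum.
move: lb; rewrite double_count => lb.
have := leq_trans lb ub; rewrite leq_pmul2r //; lia.
Qed.

End Matchings.

(** * Degree-preserving switches and degrees within a component *)

Section Exchanges.
Variable T : finType.
Implicit Types (F G H : sgraph T) (P V K : {set T}) (N M : {ffun T -> T}).

Lemma edge_diffE F G x y : edge_diff G F x y = G x y && ~~ F x y.
Proof. by []. Qed.

Lemma degree_edge_diff F G x : subgraph F G ->
  degree (edge_diff G F) x + degree F x = degree G x.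
Proof.
move=> sFG; rewrite /degree -(cardsID [set y | F x y] [set y | G x y]) addnC.
have -> : [set y | G x y] :&: [set y | F x y] = [set y | F x y].
  by apply/setIidPr/subsetP=> y; rewrite !inE; exact: sFG.
have -> // : [set y | G x y] :\: [set y | F x y] = [set y | edge_diff G F x y].
by apply/setP=> y; rewrite !inE andbC.
Qed.

Definition link (p q : T) : rel T :=
  [rel x y | (x == p) && (y == q) || (x == q) && (y == p)].

Lemma link_sym p q : symmetric (link p q).
Proof. by move=> x y; rewrite /link /= orbC andbC [X in _ || X]andbC. Qed.

Lemma card_switch (A B : {set T}) y1 y2 : y1 \in A -> y2 \notin A ->
  (forall y, (y \in B) = (y \in A) && (y != y1) || (y == y2)) -> #|B| = #|A|.
Proof.
move=> A1 A2 BE; rewrite (cardsD1 y1 A) (cardsD1 y2 B) A1 BE eqxx orbT.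
congr (_ + _); apply: eq_card => y; rewrite in_setD1 BE in_setD1.
by have [->|] := eqVneq y y2; [rewrite (negPf A2) andbF | rewrite orbF /= andbC].
Qed.

Lemma swap_edges G a b c e :
  G a b -> G c e -> ~~ G a c -> ~~ G b e -> a != c -> b != e ->
  exists G', [/\ forall x, degree G' x = degree G x, G' a c &
    forall x y, G x y -> ~~ link a b x y -> ~~ link c e x y -> G' x y].
Proof.
move=> ab ce ac be nac nbe.
have nab : a != b by apply: contraTneq ab => ->; rewrite (adj_irr G).
have nce : c != e by apply: contraTneq ce => ->; rewrite (adj_irr G).
have nae : a != e by apply: contraNneq ac => ->; rewrite (adj_sym G).
have nbc : b != c by apply: contraNneq ac => <-.
pose R := [rel x y | [&& G x y, ~~ link a b x y & ~~ link c e x y]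
                     || (link a c x y || link b e x y)].
have Rsym : symmetric R.
  by move=> x y; rewrite /R /= (adj_sym G) !(link_sym _ _ x y).
have Rirr : irreflexive R.
  move=> x; rewrite /R /= (adj_irr G) /=; apply/negP.
  by case/orP=> /orP[] /andP[/eqP->]; rewrite ?(negPf nac) ?(negPf nbe) // eq_sym
    ?(negPf nac) ?(negPf nbe).
exists (SGraph Rsym Rirr); split=> /= [x| |x y]; last by rewrite /R /= => -> -> ->.
  2: by rewrite /R /link /= !eqxx orbT.
have [[ba ec] [ea cb] [ca eb]] :
    [/\ (b == a) = false /\ (e == c) = false, (e == a) = false /\ (c == b) = false
      & (c == a) = false /\ (e == b) = false].
  by split; rewrite eq_sym (negPf nab, negPf nae, negPf nac) eq_sym
    (negPf nce, negPf nbc, negPf nbe).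
have neqs := (negPf nab, negPf nce, negPf nae, negPf nbc, negPf nac, negPf nbe,
  (ba, ec), (ea, cb), (ca, eb)).
rewrite /degree; have [->|xa] := eqVneq x a.
  apply: (@card_switch _ _ b c); rewrite ?inE // => y.
  by rewrite !inE /R /link /= !eqxx !neqs /= ?andbT ?orbF.
have [->|xb] := eqVneq x b.
  apply: (@card_switch _ _ a e); rewrite ?inE ?(adj_sym G b a) // => y.
  by rewrite !inE /R /link /= !eqxx !neqs /= ?andbT ?orbF.
have [->|xc] := eqVneq x c.
  apply: (@card_switch _ _ e a); rewrite ?inE ?(adj_sym G c a) // => y.
  by rewrite !inE /R /link /= !eqxx !neqs /= ?andbT ?orbF.
have [->|xe] := eqVneq x e.
  apply: (@card_switch _ _ c b); rewrite ?inE ?(adj_sym G e) // => y.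
  by rewrite !inE /R /link /= !eqxx !neqs /= ?andbT ?orbF.
apply: eq_card => y.
by rewrite !inE /R /link /= (negPf xa) (negPf xb) (negPf xc) (negPf xe) /= andbT orbF.
Qed.

(* When [#|P| <= m] the sum is at least [#|P| * (m + 1 - #|P|)], a concave function of
   [#|P|] equal to [m] at both ends of the range. *)
Lemma sum_component_lb P (out : T -> nat) m : P != set0 ->
  (forall q, q \in P -> m < out q + #|P|) ->
  (m < #|P| -> m <= \sum_(q in P) out q) ->
  m <= \sum_(q in P) out q.
Proof.
rewrite -card_gt0 => P0 hout hbig; have [|le] := ltnP m #|P|; first exact: hbig.
apply: leq_trans (_ : #|P| * (m.+1 - #|P|) <= _).
  by case: #|P| P0 le => // p _ le; nia.
by rewrite -sum_nat_const; apply: leq_sum => q /hout; lia.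
Qed.

(** A neighbour of [q] in D lies in [P] and any other lies in A; the inequality is strict because
    [q] belongs to [P] without being its own neighbour. *)
Lemma degree_component H V P q : P \in components_in H (missable H V) -> q \in P ->
  (forall y, H q y -> y \in V) ->
  degree H q < #|[set a in frontier H V | H q a]| + #|P|.
Proof.
move=> PV qP qV; rewrite [X in _ + X](cardsD1 q) qP add1n addnS ltnS.
apply: leq_trans (leq_card_setU _ _); apply/subset_leq_card/subsetP=> y.
rewrite inE => qy; rewrite in_setU in_setD1.
have qD := subsetP (component_sub PV) _ qP.
have [yD|yD] := boolP (y \in missable H V).
  rewrite (component_adj PV qP yD qy) andbT.
  by rewrite [y == q](_ : _ = false) ?orbT //; apply: contraTF qy => /eqP->; rewrite (adj_irr H).
apply/orP; left; rewrite inE qy andbT inE qV // yD /=.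
by apply/existsP; exists q; rewrite qD (adj_sym H).
Qed.

End Exchanges.

(** * Optimal pairs of a realization and a matching *)

Section Packing.
Variables (T : finType) (F : sgraph T) (d : T -> nat).
Implicit Types (G : sgraph T) (N M : {ffun T -> T}).

Definition extension G := (forall x, degree G x = d x) /\ subgraph F G.

Definition optimal G N := [/\ extension G, matching (edge_diff G F) setT N &
  forall G' N', extension G' -> matching (edge_diff G' F) setT N' ->
    #|exposed N| <= #|exposed N'|].

(** Descent on the number of missed vertices, from the identity, which is the empty matching. *)
Lemma exists_optimal G : extension G -> exists G' N, optimal G' N.
Proof.
move=> eG.
have m0 : matching (edge_diff G F) setT [ffun x => x].
  by apply/matchingP; split=> x; rewrite !ffunE ?eqxx.
move: {2}#|_| (leqnn #|exposed [ffun x : T => x]|) => n.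
elim: n G [ffun x => x] eG m0 => [|n IHn] G N eG mN leN.
  by exists G, N; split=> // G' N' _ _; rewrite (leq_trans leN).
have [[G' [N' [eG' mN' lt]]]|none] := classic (exists G' N',
    [/\ extension G', matching (edge_diff G' F) setT N' & #|exposed N'| < #|exposed N|]).
  by apply: IHn eG' mN' _; rewrite -ltnS (leq_trans lt).
exists G, N; split=> // G' N' eG' mN'; rewrite leqNgt; apply/negP => lt.
by apply: none; exists G', N'.
Qed.

Lemma optimal_max G N : optimal G N -> max_matching (edge_diff G F) setT N.
Proof. by case=> eG mN hN; apply/max_matchingP; split=> // M; exact: hN. Qed.

Lemma optimal_of_card G N G' N' : optimal G N -> extension G' ->
  matching (edge_diff G' F) setT N' -> #|exposed N'| <= #|exposed N| -> optimal G' N'.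
Proof.
by move=> [_ _ hN] eG' mN' le; split=> // G1 N1 eG1 mN1; apply: leq_trans le (hN _ _ eG1 mN1).
Qed.

Lemma optimal_max_matching G N M : optimal G N ->
  max_matching (edge_diff G F) setT M -> optimal G M.
Proof.
move=> oN xM; have [eG _ _] := oN; have [mM _] := max_matchingP _ _ _ xM.
by apply: (optimal_of_card oN eG mM); rewrite (max_matching_eq xM (optimal_max oN)).
Qed.

(** The two edges removed are outside [F], so [F] survives; each of them meets [{a, c}], so a
    matching missing [a] and [c] survives as well. *)
Lemma swap_extension G a b c e : extension G ->
  edge_diff G F a b -> edge_diff G F c e -> ~~ G a c -> ~~ G b e ->
  a != c -> b != e ->
  exists G', [/\ extension G', edge_diff G' F a c &
    forall x y, edge_diff G F x y -> x \notin [set a; c] -> y \notin [set a; c] ->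
      edge_diff G' F x y].
Proof.
move=> [dG sFG] /andP[ab Fab] /andP[ce Fce] ac be nac nbe.
have [G' [dG' ac' keep]] := swap_edges ab ce ac be nac nbe.
have nlink p q x y : ~~ F p q -> F x y -> ~~ link p q x y.
  move=> Fpq xy; apply: contra Fpq => /orP[] /andP[/eqP<- /eqP<-] //.
  by rewrite (adj_sym F).
exists G'; split.
- split=> [x|x y xy]; first by rewrite dG' dG.
  by apply: keep (sFG _ _ xy) _ _; exact: nlink xy.
- by rewrite edge_diffE ac' /=; apply: contra ac => /sFG.
- move=> x y /andP[xy Fxy]; rewrite !inE !negb_or => /andP[xa xc] /andP[ya yc].
  rewrite edge_diffE Fxy andbT; apply: keep => //; rewrite /link /=.
    by rewrite (negPf xa) (negPf ya) andbF.
  by rewrite (negPf xc) (negPf yc) andbF.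
Qed.

(* Otherwise switching [pu], [qw] into [pq], [uw] would allow [pq] to join [N]. *)
Lemma exposed_neighbors_adj G N p q u w : optimal G N -> N p = p -> N q = q ->
  p != q -> ~~ F p q -> edge_diff G F p u -> edge_diff G F q w -> u != w -> G u w.
Proof.
move=> oN Np Nq pq Fpq pu qw uw; have [eG mN hN] := oN.
have := exposed_nonadj (optimal_max oN) (in_setT p) (in_setT q) Np Nq.
rewrite edge_diffE Fpq andbT => Gpq; apply/negPn/negP => Guw.
have [G' [eG' pq' keep]] := swap_extension eG pu qw Gpq Guw pq uw.
have mN' : matching (edge_diff G' F) setT N.
  apply/matchingP; split=> [|x Nx]; first exact: matchingK mN.
  split; first exact: in_setT.
  apply: keep (matching_adj mN Nx) _ _; rewrite !inE negb_or.
    by apply/andP; split; apply: contraNneq Nx => ->; rewrite ?Np ?Nq.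
  by apply/andP; split; apply: contraNneq Nx => Nxp;
    rewrite -[X in _ == X](matchingK mN) Nxp ?Np ?Nq.
have := hN _ _ eG' (matching_add mN' (in_setT p) (in_setT q) Np Nq pq').
by rewrite (card_exposed_add Np Nq pq) ltnNge leqnSn.
Qed.

(* [z (N z)] is replaced in the matching by [q (N z)], if necessary after switching
   [qu], [z (N z)] into [q (N z)], [uz]. *)
Lemma expose_matched G N q z u : optimal G N -> N q = q -> N z != z ->
  ~~ F q (N z) -> edge_diff G F q u -> u != z -> ~~ G u z ->
  exists G' N', optimal G' N' /\ N' z = z.
Proof.
move=> oN Nq Nz Fqz qu uz Guz; have [eG mN hN] := oN; have NK := matchingK mN.
have qz : q != z by apply: contraNneq Nz => <-; rewrite Nq.
have qNz : q != N z by apply: contraNneq qz => qE; rewrite -(inj_eq (can_inj NK)) Nq qE.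
suff [G' [eG' qz' keep]] : exists G', [/\ extension G', edge_diff G' F q (N z) &
    forall x y, edge_diff G F x y -> x \notin [set q; N z] -> y \notin [set q; N z] ->
      edge_diff G' F x y].
  have Dq : del_edge N z q = q by rewrite ffunE Nq; case: ifP.
  have DNz : del_edge N z (N z) = N z by rewrite ffunE eqxx orbT.
  have mD : matching (edge_diff G' F) setT (del_edge N z).
    apply/matchingP; split=> [|x]; first exact: del_edgeK.
    rewrite ffunE; case: ifP => [|/negbT]; first by rewrite eqxx.
    rewrite negb_or => /andP[xz xNz] Nx; split; first exact: in_setT.
    apply: keep (matching_adj mN Nx) _ _; rewrite !inE negb_or.
      by rewrite xNz andbT; apply: contraNneq Nx => ->; rewrite Nq.
    rewrite (inj_eq (can_inj NK)) xz andbT; apply: contraNneq Nx => Nxq.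
    by rewrite -[X in _ == X]NK Nxq Nq.
  exists G', (add_edge (del_edge N z) q (N z)); split; last first.
    by rewrite ffunE eq_sym (negPf qz) eq_sym (negPf Nz) ffunE eqxx.
  apply: optimal_of_card oN eG' (matching_add mD _ _ Dq DNz qz') _; rewrite ?in_setT //.
  by have := card_exposed_add Dq DNz qNz; rewrite card_exposed_del // => -[<-].
have [GqNz|GqNz] := boolP (G q (N z)).
  by exists G; split=> //; rewrite edge_diffE GqNz.
apply: swap_extension Guz _ _ => //.
by rewrite (adj_sym (edge_diff G F)); exact: matching_adj mN Nz.
Qed.

Variables (K : {set T}) (dmin dmax r : nat).
Hypotheses (dmin_le : forall x, dmin <= d x) (le_dmax : forall x, d x <= dmax).
Hypotheses (F_le : forall x, degree F x <= r) (r_dmin : 2 * r <= dmin).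
Hypothesis dmin_gt0 : 0 < dmin.
Hypothesis K_degree : forall z, z \in K -> dmax - dmin + 2 * r <= d z.
Hypothesis K_card : dmax - dmin + 2 * r + 1 <= #|K|.

(** A lower bound for all degrees in [G - E(F)], and the number of edges wanted from each component
    of D to A. *)
Let m := dmin - r.

Lemma card_F_le (A : {set T}) x : #|[set y in A | F x y]| <= r.
Proof.
apply: leq_trans (F_le x); apply/subset_leq_card/subsetP=> y.
by rewrite !inE => /andP[].
Qed.

Lemma degree_diff_ge G x : extension G -> m <= degree (edge_diff G F) x.
Proof.
move=> [dG sFG]; have := degree_edge_diff x sFG; rewrite dG.
have := dmin_le x; have := F_le x; rewrite /m; clear; lia.
Qed.

Lemma degree_ge G (A : {set T}) u : extension G -> (forall y, y \in A -> G u y) ->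
  #|A| <= dmax.
Proof.
move=> [dG _] hA; apply: leq_trans (le_dmax u); rewrite -dG.
by apply/subset_leq_card/subsetP=> y /hA; rewrite inE.
Qed.

Lemma optimal_exposes_high G N : optimal G N -> 0 < #|exposed N| ->
  exists G' N' z, [/\ optimal G' N', z \in K & N' z = z].
Proof.
move=> oN N0; apply: NNPP => noK.
have hK G' N' z : optimal G' N' -> z \in K -> N' z != z.
  by move=> oN' zK; apply/eqP => N'z; apply: noK; exists G', N', z.
have [eG mN hN] := oN; pose H := edge_diff G F.
have xN := optimal_max oN.
pose D := missable H setT.
have KD z : z \in K -> z \notin D.
  move=> zK; apply/negP => /missableP[_ [M xM Mz]].
  by have := hK _ _ z (optimal_max_matching oN xM) zK; rewrite Mz eqxx.
have dom M q u z : max_matching H setT M -> M q = q -> H q u ->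
    z \in K -> ~~ F q (M z) -> z != u -> G u z.
  move=> xM Mq qu zK Fqz zu; apply/negPn/negP => Guz.
  have oM := optimal_max_matching oN xM; apply: noK.
  have [|G' [N' [oN' N'z]]] := expose_matched oM Mq (hK _ _ _ oM zK) Fqz qu _ Guz.
    by rewrite eq_sym.
  by exists G', N', z.
have cardFM M q : max_matching H setT M -> #|[set z in K | F q (M z)]| <= r.
  move=> /max_matchingP[/matchingK MK _].
  rewrite -(card_imset _ (can_inj MK)); apply: leq_trans (F_le q).
  by apply/subset_leq_card/subsetP=> y /imsetP[z]; rewrite !inE => /andP[_ Fz] ->.
have [||P PD|u uA mu] := @frontier_heavy _ H setT N m xN; rewrite ?setIT //.
- by rewrite /m; clear -r_dmin dmin_gt0; lia.
- apply: sum_component_lb (component_neq0 PD) _ _ => [q qP|mP].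
    apply: leq_ltn_trans (degree_diff_ge q eG) (degree_component PD qP _).
    by move=> y _; exact: in_setT.
  apply: leq_trans (ltnW mP) _; rewrite -sum1_card; apply: leq_sum => q qP.
  have P1 : 1 < #|P| by apply: leq_trans mP; rewrite ltnS /m; clear -r_dmin dmin_gt0; lia.
  have [q2 q2P qq2] := component_neighbor PD P1 qP.
  have qD := subsetP (component_sub PD) _ qP.
  have /missableP[_ [M xM Mq2]] := subsetP (component_sub PD) _ q2P.
  (* Being an [H]-neighbour of the missed [q2], [q] is joined in [G] to all of [K] but at most [r]
     vertices, and at most [r] of these edges are in [F]. As [K] has at least [2r + 1] vertices and
     avoids D, [q] has a neighbour in A. *)
  have sK : K \subset [set z in K | F q2 (M z)] :|: [set z in K | F q z] :|:
      [set a in frontier H setT | H q a].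
    apply/subsetP=> z zK; rewrite !in_setU; have zD := KD z zK.
    have -> : (z \in [set z in K | F q2 (M z)]) = F q2 (M z) by rewrite inE zK.
    have -> : (z \in [set z in K | F q z]) = F q z by rewrite inE zK.
    have [//|Fq2] /= := boolP (F q2 (M z)); have [//|Fqz] /= := boolP (F q z).
    have zq : z != q by apply: contraNneq zD => ->.
    have Hqz : H q z.
      by rewrite edge_diffE Fqz andbT; apply: dom xM Mq2 _ zK Fq2 zq; rewrite (adj_sym H).
    have zF : z \in frontier H setT.
      rewrite inE in_setT zD; apply/existsP; exists q.
      by rewrite qD (adj_sym H).
    by rewrite inE zF.
  have := subset_leq_card sK; have := cardFM M q2 xM; have := card_F_le K q.
  have := leq_of_leqif (leq_card_setU
    ([set z in K | F q2 (M z)] :|: [set z in K | F q z]) [set a in frontier H setT | H q a]).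
  have := leq_of_leqif (leq_card_setU [set z in K | F q2 (M z)] [set z in K | F q z]).
  by rewrite -/H; clear -K_card; lia.
have /set0Pn[q] : [set q in D | H u q] != set0.
  by rewrite -card_gt0; apply: leq_ltn_trans mu.
rewrite inE => /andP[qD uq]; have /missableP[_ [M xM Mq]] := qD.
have qu : H q u by rewrite (adj_sym H).
pose K' := K :\: [set z in K | F q (M z)] :\ u.
have cU : #|[set q in D | H u q] :|: K'| = #|[set q in D | H u q]| + #|K'|.
  rewrite cardsU (_ : _ :&: _ = set0) ?cards0 ?subn0 //; apply/setP=> z.
  rewrite in_setI in_set0 /K' in_setD1 in_setD.
  have [/KD zD|] := boolP (z \in K); last by rewrite !andbF.
  by rewrite inE (negPf zD).
have cK : #|K| <= #|K'| + r + 1.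
  have := cardsID [set z in K | F q (M z)] K; rewrite (cardsD1 u (K :\: _)) -/K'.
  have := subset_leq_card (subsetIr K [set z in K | F q (M z)]).
  have := cardFM M q xM; case: (u \in _); clear; lia.
(* [u] has at least [dmin - r + 1] neighbours in D and [dmax - dmin + r] in [K'], hence more than
   [dmax] in all. *)
have := @degree_ge G ([set q in D | H u q] :|: K') u eG; rewrite cU.
suff nb : forall y, y \in [set q in D | H u q] :|: K' -> G u y.
  move/(_ nb); move: mu K_card cK (dmin_le u) (le_dmax u).
  by rewrite /m -/D; clear -r_dmin dmin_gt0; lia.
move=> y; rewrite in_setU => /orP[|].
  by rewrite inE => /andP[_] /andP[].
rewrite /K' in_setD1 in_setD => /and3P[yu + yK]; rewrite inE yK /= => Fqy.
exact: dom xM Mq qu yK Fqy yu.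
Qed.


(** A maximum matching of [H - z] is still optimal for [G] and misses [z], so every vertex missable
    in [H - z] is missed together with [z], and [exposed_neighbors_adj] applies to it. *)
Lemma exposed_high_absurd G N z : optimal G N -> 1 < #|exposed N| -> z \in K ->
  N z = z -> False.
Proof.
move=> oN N1 zK Nz; have [eG mN hN] := oN; pose H := edge_diff G F.
pose V := [set~ z]; pose D := missable H V; pose Z := [set v | H z v].
have mNV : matching H V N.
  apply/matchingP; split=> [|x Nx]; first exact: matchingK mN.
  rewrite (matching_adj mN Nx); split=> //; rewrite !inE.
  by apply: contraNneq Nx => ->; rewrite Nz.
have optV M : max_matching H V M -> optimal G M /\ M z = z.
  move=> xM; have [mM hM] := max_matchingP _ _ _ xM.
  have Mz : M z = z by apply: (matching_out mM); rewrite !inE eqxx.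
  split=> //; apply: (optimal_of_card oN eG (matching_sub (subsetT V) mM)).
  exact: hM.
have xN : max_matching H V N.
  by apply/max_matchingP; split=> // M mM; exact: hN eG (matching_sub (subsetT V) mM).
have N0 : 0 < #|exposed N :&: V|.
  have -> : exposed N :&: V = exposed N :\ z by apply/setP=> x; rewrite !inE andbC.
  by move: N1; rewrite (cardsD1 z) inE Nz eqxx.
have DV q : q \in D -> q != z by case/missableP; rewrite !inE.
have zD q : q \in D -> ~~ H z q.
  case/missableP=> _ [M xM Mq]; have [oM Mz] := optV M xM.
  exact: exposed_nonadj (optimal_max oM) (in_setT _) (in_setT _) Mz Mq.
have HV q y : q \in D -> H q y -> y \in V.
  move=> qD qy; rewrite !inE; apply: contraTneq qy => ->.
  by rewrite (adj_sym H) zD.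
have dom q v w : q \in D -> ~~ F z q -> v \in Z -> H q w -> v != w -> G v w.
  move=> qD Fzq; rewrite inE => zv qw vw; have /missableP[_ [M xM Mq]] := qD.
  have [oM Mz] := optV M xM.
  by apply: (exposed_neighbors_adj oM Mz Mq _ Fzq zv qw vw); rewrite eq_sym DV.
have Zm : m <= #|Z| by exact: degree_diff_ge.
have Zk : dmax - dmin + r <= #|Z|.
  have [dG sFG] := eG; have := degree_edge_diff z sFG; rewrite dG.
  have := K_degree zK; have := F_le z; rewrite /degree -/Z; clear; lia.
have mr : r <= m by rewrite /m; clear -r_dmin; lia.
have m0 : 0 < m by rewrite /m; clear -r_dmin dmin_gt0; lia.
have [P PD|u uA mu] := frontier_heavy xN N0 m0; last first.
  pose S := [set q in D | H u q].
  have [q qS Fzq] : exists2 q, q \in S & ~~ F z q.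
    apply/exists_inP; rewrite -negb_forall_in; apply/negP => /forall_inP hF.
    have sS : S \subset [set y in S | F z y] by apply/subsetP=> q qS; rewrite inE qS hF.
    have := subset_leq_card sS; have := card_F_le S z; move: mu mr; rewrite -/S.
    by clear; lia.
  have [qD uq] : q \in D /\ H u q by move: qS; rewrite inE => /andP[].
  have nb y : y \in S :|: Z :\ u -> G u y.
    rewrite in_setU in_setD1 => /orP[|/andP[yu yZ]]; first by rewrite inE => /andP[_ /andP[]].
    rewrite (adj_sym G); apply: (dom q y u qD Fzq yZ) => //.
    by rewrite (adj_sym H).
  have cSZ : #|S :|: Z :\ u| = #|S| + #|Z :\ u|.
    rewrite cardsU (_ : _ :&: _ = set0) ?cards0 ?subn0 //; apply/setP=> y.
    rewrite in_setI in_set0 in_setD1; apply/negP=> /and3P[].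
    by rewrite inE => /andP[/zD/negP zy _] _; rewrite inE => /zy.
  (* [S] and [Z] are disjoint and have at least [dmin - r + 1] and [dmax - dmin + r] vertices. If
     [u] is in [Z], it is lost as its own neighbour, but [z] is gained. *)
  have [uZ|uZ] := boolP (u \in Z); last first.
    have := degree_ge eG nb; rewrite cSZ.
    rewrite (_ : Z :\ u = Z); last by apply/setDidPl; rewrite disjoint_sym disjoints1.
    by move: mu Zk (dmin_le u) (le_dmax u); rewrite -/S /m; clear; lia.
  have zSZ : z \notin S :|: Z :\ u.
    rewrite in_setU in_setD1 [z \in Z]inE (adj_irr H) andbF orbF.
    by apply/negP; rewrite inE => /andP[/DV/eqP].
  have nbz y : y \in z |: (S :|: Z :\ u) -> G u y.
    rewrite in_setU1 => /orP[/eqP->|]; last exact: nb.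
    by move: uZ; rewrite inE (adj_sym H) => /andP[].
  have := degree_ge eG nbz; rewrite cardsU1 zSZ cSZ.
  move: Zk; rewrite (cardsD1 u Z) uZ.
  by move: mu (dmin_le u) (le_dmax u); rewrite -/S /m; clear; lia.
have PsD := subsetP (component_sub PD).
pose out q := #|[set a in frontier H V | H q a]|; rewrite -/out.
have outE q a : q \in D -> H q a -> a \notin D -> a \in [set a in frontier H V | H q a].
  move=> qD qa aD; rewrite inE qa andbT inE (HV q a qD qa) aD.
  by apply/existsP; exists q; rewrite qD (adj_sym H).
have outNP q y : q \in P -> H q y -> y \notin P -> 0 < out q.
  move=> qP qy yP; rewrite card_gt0; apply/set0Pn; exists y.
  apply: outE => //; first exact: PsD.
  by apply: contra yP => yD; apply: component_adj PD qP yD qy.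
apply: sum_component_lb (component_neq0 PD) _ _ => [q qP|mP].
  apply: leq_ltn_trans (degree_diff_ge q eG) (degree_component PD qP _).
  by move=> y; apply: HV (PsD q qP).
(* [W] is completely joined to [Z] in [G].  If it has more than [r] vertices, every
   vertex of [Z] has an [H]-neighbour in [W]; otherwise every vertex of [P] has an
   outgoing edge, except in an extremal case where the [m] vertices of [W] do. *)
pose B := [set q in P | F z q].
pose W := [set q in P | [exists y in P :\: B, H q y]].
have cB : #|B| <= r by exact: card_F_le.
have Wdom q v : q \in W -> v \in Z -> G v q.
  rewrite inE => /andP[qP /existsP[y /andP[]]]; rewrite in_setD => /andP[+ yP] qy.
  rewrite inE yP /= => Fzy vZ; apply: (dom y v q (PsD y yP) Fzy vZ).
    by rewrite (adj_sym H).
  by apply: contraTneq vZ => ->; rewrite inE zD // PsD.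
have WP : W \subset P by apply/subsetP=> q; rewrite inE => /andP[].
have inW q y : q \in P -> H q y -> y \in P -> y \notin B -> q \in W.
  by move=> qP qy yP yB; rewrite inE qP; apply/existsP; exists y; rewrite in_setD yB yP.
have ZD v : v \in Z -> v \notin D by rewrite inE => zv; apply: contraL zv; exact: zD.
have [ltW|leW] := ltnP r #|W|.
  apply: leq_trans (_ : \sum_(q in P) #|[set v in Z | H q v]| <= _); last first.
    apply: leq_sum => q qP; apply/subset_leq_card/subsetP=> v.
    by rewrite inE => /andP[vZ qv]; apply: outE (PsD q qP) qv (ZD v vZ).
  rewrite double_count; apply: leq_trans Zm _; rewrite -sum1_card; apply: leq_sum => v vZ.
  have sW : W \subset [set q in P | H v q] :|: [set q in W | F v q].
    apply/subsetP=> q qW; have Gvq := Wdom q v qW vZ.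
    rewrite in_setU [X in X || _]inE [X in _ || X]inE qW (subsetP WP q qW) edge_diffE Gvq.
    by case: (F v q).
  have := subset_leq_card sW; have := card_F_le W v.
  have := leq_of_leqif (leq_card_setU [set q in P | H v q] [set q in W | F v q]).
  by clear -ltW; lia.
(* Without an outgoing edge, a [q] in [W] would be joined by [F] to all of [Z] and to [z], more than
   [r] vertices; a [q] outside [W] would have all its [H]-neighbours in [B :\ q], fewer than [m]. *)
have hB q : q \in B -> 0 < out q.
  move=> qB; have [qP Fzq] : q \in P /\ F z q by move: qB; rewrite inE => /andP[].
  have qD := PsD q qP; rewrite lt0n; apply/negP => /eqP out0.
  have [qW|qW] := boolP (q \in W).
    have sZ : Z \subset [set v | F q v] :\ z.
      apply/subsetP=> v vZ; rewrite in_setD1.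
      have -> : v != z by apply: contraTneq vZ => ->; rewrite inE (adj_irr H).
      rewrite inE; apply/negPn/negP => Fqv.
      have : v \in [set a in frontier H V | H q a].
        apply: outE (ZD v vZ) => //.
        by rewrite edge_diffE Fqv andbT (adj_sym G); exact: Wdom.
      by rewrite (cards0_eq out0) in_set0.
    have := subset_leq_card sZ; have := F_le q.
    rewrite /degree (cardsD1 z [set y | F q y]) inE (adj_sym F) Fzq.
    by clear -Zm mr; lia.
  have sB : [set y | H q y] \subset B :\ q.
    apply/subsetP=> y; rewrite inE => qy; rewrite in_setD1.
    have -> : y != q by apply: contraTneq qy => ->; rewrite (adj_irr H).
    have yP : y \in P by apply/negPn/negP => /(outNP q y qP qy); rewrite out0.
    by apply/negPn/negP => yB; case/negP: qW; apply: inW yP yB.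
  have := subset_leq_card sB; have := degree_diff_ge q eG; rewrite -/H /degree.
  by move: cB; rewrite (cardsD1 q B) qB; clear -mr; lia.
have [all1|] := boolP [forall q in P, 0 < out q].
  apply: leq_trans (ltnW mP) _; rewrite -sum1_card; apply: leq_sum => q qP.
  by have /forallP/(_ q)/implyP/(_ qP) := all1.
rewrite negb_forall => /existsP[q]; rewrite negb_imply -eqn0Ngt => /andP[qP /eqP out0].
have qB : q \notin B by apply/negP => /hB; rewrite out0.
(* All [H]-neighbours of this [q] lie in [W], so [m <= #|W| <= r <= m] and [W] is its neighbourhood.
   A vertex of [W] outside [B] would put [q] into [W], making it its own neighbour. *)
have sW : [set y | H q y] \subset W.
  apply/subsetP=> y; rewrite inE => qy.
  have yP : y \in P by apply/negPn/negP => /(outNP q y qP qy); rewrite out0.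
  by apply: inW yP _ qP qB; rewrite (adj_sym H).
have degq := degree_diff_ge q eG.
have eqW : [set y | H q y] = W.
  by apply/eqP; rewrite eqEcard sW; apply: leq_trans degq; exact: leq_trans mr.
have WB : W \subset B.
  apply/subsetP=> w wW; apply/negPn/negP => wB.
  have qw : H q w by move: wW; rewrite -eqW inE.
  have := inW q w qP qw (subsetP WP w wW) wB.
  by rewrite -eqW inE (adj_irr H).
apply: leq_trans (_ : #|W| <= _); first by rewrite -eqW.
rewrite -sum1_card [leqRHS](big_setID W) /= (setIidPr WP).
by apply: leq_trans (leq_addr _ _); apply: leq_sum => w /(subsetP WB); exact: hB.
Qed.

End Packing.

(** * From the degree sequence to the packing hypotheses *)

Lemma term_ord n (d : n.-tuple nat) (i : 'I_n) : term d i.+1 = tnth d i.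
Proof. by rewrite /term (tnth_nth 0). Qed.

Lemma card_ord_lt n k : k <= n -> #|[set i : 'I_n | i < k]| = k.
Proof.
move=> kn; have winj : injective (widen_ord kn) by move=> x y [] /val_inj.
rewrite -[RHS]card_ord -cardsT -(card_imset _ winj); apply: eq_card => i.
rewrite inE; apply/idP/imsetP => [ik|[j _ ->]]; last by rewrite /= ltn_ord.
by exists (Ordinal ik); last exact: val_inj.
Qed.

Theorem theoremA1 (n : nat) (d : n.-tuple nat)
    (hmono : nonincreasing d) (hpos : positive_seq d) (hgraphic : graphic d)
    (F : sgraph 'I_n)
    (hF : exists G0 : sgraph 'I_n, realizes G0 d /\ subgraph F G0)
    (r : nat) (hr : r = max_degree F)
    (hidx : 1 <= term d 1 - term d n + 2 * r + 1 <= n)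
    (hterm : term d 1 - term d n + 2 * r
               <= term d (term d 1 - term d n + 2 * r + 1)) :
  exists G : sgraph 'I_n,
    [/\ realizes G d, subgraph F G & deficiency (edge_diff G F) <= 1].
Proof.
have n0 : 0 < n by case/andP: hidx; lia.
pose i1 : 'I_n := Ordinal n0.
have ltn1 : n.-1 < n by rewrite prednK.
pose i_n : 'I_n := Ordinal ltn1.
have e1 : term d 1 = tnth d i1 by rewrite -term_ord.
have en : term d n = tnth d i_n by rewrite -term_ord /= prednK.
have dmin_le i : term d n <= tnth d i.
  by rewrite en; apply: hmono; rewrite /= -ltnS prednK.
have le_dmax i : tnth d i <= term d 1 by rewrite e1; exact: hmono.
set k := term d 1 - term d n + 2 * r in hidx hterm *.
have ltk : k < n by move: hidx; clear; lia.
(* Ordinals count from 0, so [ik] is the vertex of 1-based index [k + 1] in the hypothesis; by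
   monotonicity the first [k + 1] vertices all lie in [K]. *)
pose ik : 'I_n := Ordinal ltk.
have dk : k <= tnth d ik by move: hterm; rewrite addn1 (term_ord d ik).
pose K := [set i : 'I_n | k <= tnth d i].
have K_card : k + 1 <= #|K|.
  rewrite addn1 -(card_ord_lt ltk); apply/subset_leq_card/subsetP=> i.
  by rewrite !inE => ltik; apply: leq_trans dk _; apply: hmono; rewrite /= -ltnS.
have K_degree i : i \in K -> k <= tnth d i by rewrite inE.
have F_le i : degree F i <= r by rewrite hr; exact: leq_bigmax.
have dmin_gt0 : 0 < term d n by rewrite en; exact: hpos.
(* The term of index [k + 1] is at least [k] and at most [d_1], so [d_1 - d_n + 2r <= d_1]. *)
have r_dmin : 2 * r <= term d n.
  by move: (leq_trans dk (le_dmax ik)) (dmin_le i1); rewrite -e1 /k; clear; lia.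
have [G0 hG0] := hF.
have [G [N oN]] := exists_optimal hG0.
have [[dG sFG] mN hN] := oN.
exists G; split=> //; rewrite leqNgt; apply/negP => lt1.
have N1 : 1 < #|exposed N| := leq_trans lt1 (deficiency_le_exposed mN).
have [G' [N' [z [oN' zK N'z]]]] := optimal_exposes_high dmin_le le_dmax F_le r_dmin
  dmin_gt0 K_card oN (ltnW N1).
have [eG' mN' _] := oN'.
apply: (exposed_high_absurd dmin_le le_dmax F_le r_dmin dmin_gt0 K_degree oN' _ zK N'z).
exact: leq_trans N1 (hN _ _ eG' mN').
Qed.
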